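(* Consider a single-stage simultaneous defend-attack game with Defender decision set $\mathcal{D}$, Attacker decision set $\mathcal{A}$ and outcome space $\Theta$, with Defender's utility $u_D(d,\theta)$ and outcome densities $p_D(\theta\mid d,a)$, and with the Attacker's random utility $U_A(a,\theta)$ and random distributions $P_A(\theta\mid d,a)$, $P_A(d)$. Let $p_D(a)$ be the law of the Attacker's random optimal attack $A^*$, let $\psi_D$ be the Defender's expected utility and $d^*_{\mathrm{ARA}}=\arg\max_{d\in\mathcal{D}}\psi_D(d)$ (all as defined in the context). Suppose that: 1. $u_D$ and, almost surely, the utilities in the support of $U_A$ are positive and, respectively, continuous in $(d,\theta)$ and in $(a,\theta)$; 2. the decision sets $\mathcal{D}$ and $\mathcal{A}$ are compact; 3. $p_D(\theta\mid d,a)$ and, almost surely, the distributions in the support of $P_A(\theta\mid d,a)$ are continuous in $d$ and in $a$, respectively, and positive in $(d,a)$; 4. the proposal generating distributions $g_D$ and $g_A$ have, respectively, support $\mathcal{D}$ and $\mathcal{A}$. Then the algorithm DAPS (described in the context) defines a Markov chain $(d^{(i)},a^{(i)},\theta^{(i)})_{i\ge 0}$ with stationary distribution $$\pi_D(d,a,\theta)\ \propto\ u_D(d,\theta)\,p_D(\theta\mid d,a)\,p_D(a).$$ Moreover, a consistent mode estimator based on the marginal samples of $d$ from this Markov chain almost surely approximates $d^*_{\mathrm{ARA}}$, i.e. it converges almost surely to $d^*_{\mathrm{ARA}}$ as the number of samples tends to infinity.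
   Context: **Game.** A Defender chooses $d\in\mathcal{D}$ and, simultaneously, an Attacker chooses $a\in\mathcal{A}$; a random outcome $\theta\in\Theta$ follows. All three spaces are taken to be continuous (distributions are identified with densities). The Defender has utility $u_D(d,\theta)$ and assesses outcome densities $p_D(\theta\mid d,a)$. The Attacker's utility $u_A(a,\theta)$ and his distributions $p_A(\theta\mid d,a)$ and $p_A(d)$ (the latter being his beliefs about the Defender's decision) are not known to the Defender. She models them as random objects $U_A(a,\theta)$, $P_A(\theta\mid d,a)$, $P_A(d)$ defined on a common probability space $(\Omega,\mathcal{F},\mathcal{P})$; the superscript $\omega$ denotes a realization. **Random optimal attack.** $\Psi_A(d,x)=\int U_A(x,\theta)P_A(\theta\mid d,x)\,d\theta$ and $A^*=\arg\max_{x\in\mathcal{A}}\int\Psi_A(d,x)P_A(d)\,dd$, a random element of $\mathcal{A}$. The Defender's distribution $p_D(a)$ over attacks is defined as the law of $A^*$: $p_D(A\le a)=\mathcal{P}\{\omega: A^{*\omega}\le a\}$. **Defender's optimum.** $\psi_D(d,a)=\int u_D(d,\theta)p_D(\theta\mid d,a)\,d\theta$, $\psi_D(d)=\int\psi_D(d,a)p_D(a)\,da$, and $d^*_{\mathrm{ARA}}=\arg\max_{d\in\mathcal{D}}\psi_D(d)$. **Algorithm DAPS** (Metropolis–Hastings, proposal density $g_D(\cdot\mid\cdot)$ on $\mathcal{D}$). Choose $d^{(0)}\in\mathcal{D}$, draw $a^{(0)}\sim p_D(a)$ and $\theta^{(0)}\sim p_D(\theta\mid d^{(0)},a^{(0)})$.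 For $i=1,2,\dots$: propose $\tilde d\sim g_D(\cdot\mid d^{(i-1)})$, draw $\tilde a\sim p_D(a)$ and $\tilde\theta\sim p_D(\theta\mid\tilde d,\tilde a)$; set $(d^{(i)},a^{(i)},\theta^{(i)})=(\tilde d,\tilde a,\tilde\theta)$ with probability $$\alpha=\min\left\{1,\ \frac{u_D(\tilde d,\tilde\theta)\,g_D(d^{(i-1)}\mid\tilde d)}{u_D(d^{(i-1)},\theta^{(i-1)})\,g_D(\tilde d\mid d^{(i-1)})}\right\},$$ and $(d^{(i)},a^{(i)},\theta^{(i)})=(d^{(i-1)},a^{(i-1)},\theta^{(i-1)})$ otherwise. A consistent estimator of the mode of the marginal augmented distribution $\pi_D(d)$ is then computed from the $d$-samples. **Algorithm AAPS** (source of the draws from $p_D(a)$; proposal density $g_A(\cdot\mid\cdot)$ on $\mathcal{A}$). Draw realizations $u_A\sim U_A$, $p_A(\theta\mid d,a)\sim P_A(\theta\mid d,a)$, $p_A(d)\sim P_A(d)$. Run the analogous Metropolis–Hastings chain on $(a,d,\theta)$ with target proportional to $u_A(a,\theta)p_A(\theta\mid d,a)p_A(d)$: propose $\tilde a\sim g_A(\cdot\mid a^{(i-1)})$, draw $\tilde d\sim p_A(d)$ and $\tilde\theta\sim p_A(\theta\mid\tilde d,\tilde a)$, and accept with probability $\min\{1,\,u_A(\tilde a,\tilde\theta)g_A(a^{(i-1)}\mid\tilde a)/(u_A(a^{(i-1)},\theta^{(i-1)})g_A(\tilde a\mid a^{(i-1)}))\}$. Return a consistent estimate of the mode of the $a$-marginal;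 this is a sample of $A^*$. **Consistent mode estimator.** A sequence of estimators computed from the marginal samples of such a chain which converges almost surely, as the number of samples grows, to the mode of the corresponding marginal of the chain's stationary distribution.
   Formalization: The Defender's expected utility ψ_D(d) is assumed finite for every d; conditions 1–4 alone do not ensure this when Θ is not compact (e.g. u_D = exp(θ²) with Gaussian p_D), and then π_D cannot be normalized. *)

(* Defs.v *)
From HB Require Import structures.
From mathcomp Require Import all_boot all_order all_algebra.
From mathcomp Require Import all_classical all_reals all_analysis.

Set Implicit Arguments.
Unset Strict Implicit.
Unset Printing Implicit Defensive.

Import Order.TTheory GRing.Theory Num.Theory.
Import numFieldNormedType.Exports.

Local Open Scope classical_set_scope.
Local Open Scope ring_scope.

(* The decision sets and the outcome space are topological spaces
   D, A, Th carrying their Borel sigma-algebras; integrals "dd", "da", "dtheta"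
   are taken against reference measures muD, muA, muTh (for subsets of R^n:
   Lebesgue measure).  States are triples (d, a, theta) = (x.1.1, x.1.2, x.2).
   Conditional densities take the conditioning variables first:
     pD d a t  is  p_D(t | d, a)      gD d d'  is  g_D(d' | d).            *)

Notation borel T := (g_sigma_algebraType (@open T)).

Definition argmax (R : realType) (T : Type) (f : T -> \bar R) : set T :=
  [set x | forall y, (f y <= f x)%E].

Definition support (R : realType) (T : ptopologicalType)
    (nu : set T -> \bar R) : set T :=
  [set x | forall U, open_nbhs x U -> (0 < nu U)%E].

Definition is_density (R : realType) d (T : measurableType d)
    (mu : set T -> \bar R) (f : T -> R) : Prop :=
  [/\ measurable_fun [set: T] f, forall x, 0 <= f x &
      (\int[mu]_x (f x)%:E = 1)%E].

Definition full_support_proposal (R : realType) (T : ptopologicalType)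
    (mu : set (borel T) -> \bar R) (g : T -> T -> R) : Prop :=
  [/\ measurable_fun [set: borel T * borel T]
        (fun z : borel T * borel T => g z.1 z.2),
      forall x, is_density mu (g x : borel T -> R) &
      forall x, support (fun U : set T => \int[mu]_(y in U) (g x y)%:E)%E
                = [set: T]].

(* The Attacker's model: UA w, PAth w, PAd w are the realizations of the random
   utility and of the random densities of theta given (d, a) and of d. *)

Definition PsiA (R : realType) (D A Th : ptopologicalType)
    (muTh : set (borel Th) -> \bar R) (ua : A -> Th -> R)
    (pa : D -> A -> Th -> R) (d : D) (x : A) : \bar R :=
  (\int[muTh]_t (ua x t * pa d x t)%:E)%E.

Definition attacker_utility (R : realType) (D A Th : ptopologicalType)
    (muD : set (borel D) -> \bar R) (muTh : set (borel Th) -> \bar R)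
    (ua : A -> Th -> R) (pa : D -> A -> Th -> R) (pad : D -> R)
    (x : A) : \bar R :=
  (\int[muD]_d (PsiA muTh ua pa d x * (pad d)%:E))%E.

(* The Defender's expected utility; law is the distribution p_D(a) of A^*. *)

Definition psiDA (R : realType) (D A Th : ptopologicalType)
    (muTh : set (borel Th) -> \bar R) (uD : D -> Th -> R)
    (pD : D -> A -> Th -> R) (d : D) (a : A) : \bar R :=
  (\int[muTh]_t (uD d t * pD d a t)%:E)%E.

Definition psiD (R : realType) (D A Th : ptopologicalType)
    (law : set (borel A) -> \bar R) (muTh : set (borel Th) -> \bar R)
    (uD : D -> Th -> R) (pD : D -> A -> Th -> R) (d : D) : \bar R :=
  (\int[law]_a psiDA muTh uD pD d a)%E.

(* The augmented distribution pi_D.  Its density u_D(d, t) p_D(t | d, a) / Z is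
   taken with respect to dd p_D(da) dt, so that the factor p_D(a) sits in the
   reference measure and the law of A^* need not have a density. *)

Definition aug_ref (R : realType) (D A Th : ptopologicalType)
    (muD : {sigma_finite_measure set (borel D) -> \bar R})
    (law : probability (borel A) R)
    (muTh : {sigma_finite_measure set (borel Th) -> \bar R}) :=
  ((muD \x law) \x muTh)%E.

Definition aug_const (R : realType) (D A Th : ptopologicalType)
    (muD : {sigma_finite_measure set (borel D) -> \bar R})
    (law : probability (borel A) R)
    (muTh : {sigma_finite_measure set (borel Th) -> \bar R})
    (uD : D -> Th -> R) (pD : D -> A -> Th -> R) : \bar R :=
  (\int[aug_ref muD law muTh]_x (uD x.1.1 x.2 * pD x.1.1 x.1.2 x.2)%:E)%E.

Definition aug_density (R : realType) (D A Th : ptopologicalType)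
    (muD : {sigma_finite_measure set (borel D) -> \bar R})
    (law : probability (borel A) R)
    (muTh : {sigma_finite_measure set (borel Th) -> \bar R})
    (uD : D -> Th -> R) (pD : D -> A -> Th -> R) (x : D * A * Th) : R :=
  uD x.1.1 x.2 * pD x.1.1 x.1.2 x.2 / fine (aug_const muD law muTh uD pD).

(* The marginal density pi_D(d) of a joint density w.r.t. dd p_D(da) dt. *)
Definition marginal_d (R : realType) (D A Th : ptopologicalType)
    (law : set (borel A) -> \bar R) (muTh : set (borel Th) -> \bar R)
    (f : D * A * Th -> R) (d : D) : \bar R :=
  (\int[law]_a \int[muTh]_t (f (d, a, t))%:E)%E.

Definition past d d' (W : measurableType d) (S : measurableType d')
    (X : nat -> W -> S) (n : nat) : set_system W :=
  <<s \bigcup_(i in `I_n.+1)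
        preimage_set_system [set: W] (X i) (@measurable _ S) >>.

Definition markov_chain (R : realType) d d' (W : measurableType d)
    (S : measurableType d') (P : probability W R)
    (K : S -> {measure set S -> \bar R}) (X : nat -> W -> S) : Prop :=
  (forall n, measurable_fun [set: W] (X n)) /\
  forall n E B, past X n E -> measurable B ->
    P (E `&` X n.+1 @^-1` B) = (\int[P]_(w in E) K (X n w) B)%E.

Definition stationary (R : realType) d (S : measurableType d)
    (K : S -> {measure set S -> \bar R}) (pi : probability S R) : Prop :=
  forall B, measurable B -> (\int[pi]_x K x B)%E = pi B.

(* Expectation of f under the proposal (d~, a~, theta~) made in state x. *)
Definition proposal_mean (R : realType) (D A Th : ptopologicalType)
    (muD : set (borel D) -> \bar R) (law : set (borel A) -> \bar R)
    (muTh : set (borel Th) -> \bar R) (pD : D -> A -> Th -> R)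
    (gD : D -> D -> R) (x : D * A * Th) (f : D * A * Th -> R) : \bar R :=
  (\int[muD]_d ((gD x.1.1 d)%:E *
     \int[law]_a \int[muTh]_t (pD d a t * f (d, a, t))%:E))%E.

(* A vanishing denominator has probability 0 under the proposal. *)
Definition daps_accept (R : realType) (D A Th : Type)
    (uD : D -> Th -> R) (gD : D -> D -> R) (x y : D * A * Th) : R :=
  Num.min 1 ((uD y.1.1 y.2 * gD y.1.1 x.1.1) /
             (uD x.1.1 x.2 * gD x.1.1 y.1.1)).

Definition daps_transition (R : realType) (D A Th : ptopologicalType)
    (muD : set (borel D) -> \bar R) (law : set (borel A) -> \bar R)
    (muTh : set (borel Th) -> \bar R) (uD : D -> Th -> R)
    (pD : D -> A -> Th -> R) (gD : D -> D -> R)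
    (x : D * A * Th) (B : set (D * A * Th)) : \bar R :=
  proposal_mean muD law muTh pD gD x
    (fun y => daps_accept uD gD x y * \1_B y
              + (1 - daps_accept uD gD x y) * \1_B x).

(* A run of DAPS started at d0: Y n and acc n are the proposal made in state
   X n and the decision to accept it; given X 0, ..., X n, the proposal is drawn
   from the proposal distribution and accepted with probability daps_accept. *)
Record daps_run (R : realType) (D A Th : ptopologicalType)
    (muD : set (borel D) -> \bar R) (law : set (borel A) -> \bar R)
    (muTh : set (borel Th) -> \bar R) (uD : D -> Th -> R)
    (pD : D -> A -> Th -> R) (gD : D -> D -> R) (d0 : D)
    d (W : measurableType d) (P : probability W R)
    (X Y : nat -> W -> borel D * borel A * borel Th)
    (acc : nat -> W -> bool) : Prop := DapsRun {
  daps_measX : forall n, measurable_fun [set: W] (X n) ;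
  daps_measY : forall n, measurable_fun [set: W] (Y n) ;
  daps_measacc : forall n, measurable_fun [set: W] (acc n) ;
  daps_init : forall B, measurable B ->
    P (X 0%N @^-1` B) =
      (\int[law]_a \int[muTh]_t (pD d0 a t * \1_B (d0, a, t))%:E)%E ;
  daps_draw : forall n E B (b : bool), past X n E -> measurable B ->
    P (E `&` [set w | B (Y n w) /\ acc n w = b]) =
      (\int[P]_(w in E) proposal_mean muD law muTh pD gD (X n w)
         (fun y => ((if b then daps_accept uD gD (X n w) y
                    else 1 - daps_accept uD gD (X n w) y) * \1_B y)%R))%E ;
  daps_step : forall n w, X n.+1 w = if acc n w then Y n w else X n w
}.

Definition d_estimate (D A Th : ptopologicalType) (W : Type)
    (est : seq D -> D) (X : nat -> W -> borel D * borel A * borel Th)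
    (w : W) (n : nat) : D :=
  est (mkseq (fun i => (X i w).1.1) n).

(* The mode of a marginal density f is its maximizer, presumed unique: if f had
   several, no estimator could be consistent (D Hausdorff). *)
Definition consistent_mode_estimator (R : realType) (D A Th : ptopologicalType)
    d (W : measurableType d) (P : probability W R)
    (X : nat -> W -> borel D * borel A * borel Th)
    (f : D -> \bar R) (est : seq D -> D) : Prop :=
  forall m, argmax f m ->
    {ae P, forall w, (d_estimate est X w n @[n --> \oo] --> m)}.

(* Main.v *)
Require Import Defs.
From HB Require Import structures.
From mathcomp Require Import all_boot all_order all_algebra.
From mathcomp Require Import all_classical all_reals all_analysis.
From mathcomp Require Import measurable_realfun ring.

Import Order.TTheory GRing.Theory Num.Theory.
Import numFieldNormedType.Exports.
Local Open Scope classical_set_scope.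
Local Open Scope ring_scope.

(* With w = u_D p_D and reference measure m = dd p_D(da) dtheta, the proposal
   density is q(x, y) = g_D(d_y | d_x) p_D(theta_y | d_y, a_y), and
   w(x) q(x, y) alpha(x, y) =
     p_D(x) p_D(y) min (u_D(x) g_D(y | x), u_D(y) g_D(x | y))
   is symmetric in x and y, which is detailed balance for w / Z.  Compactness of
   D and the maximality of psi_D at d*_ARA give Z <= psi_D(d*_ARA) |D| < oo.
   The d-marginal of w / Z is psi_D / Z, so its mode is d*_ARA. *)

(** * Measurability of quotients and of continuous functions on products *)

Lemma measurable_invr (R : realType) :
  measurable_fun [set: R] (@GRing.inv R).
Proof.
(* Inversion is continuous only off 0, so the point 0 is split off; its complement is open. *)
have -> : [set: R] = [set 0] `|` ~` [set 0] by rewrite setUv.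
apply/measurable_funU => //; first exact: measurableC.
split; first exact: measurable_fun_set1.
apply: open_continuous_measurable_fun.
  by apply: closed_openC; exact: closed_eq.
by move=> x /[!inE] /eqP x0; exact: inv_continuous.
Qed.

Lemma measurable_div (R : realType) d (T : measurableType d) (f g : T -> R) :
  measurable_fun setT f -> measurable_fun setT g ->
  measurable_fun setT (fun x => f x / g x).
Proof.
move=> mf mg; apply: measurable_funM => //.
by apply: measurableT_comp => //; exact: measurable_invr.
Qed.

(** The product sigma-algebra of two Borel spaces only sees rectangles. Second countability of both
    factors makes every open set of the product a countable union of basic open rectangles, hence
    measurable for it. *)
Lemma continuous_measurable_borel_prod (R : realType) (D T : ptopologicalType)
    (u : D -> T -> R) :
  @second_countable D -> @second_countable T ->
  continuous (fun z : D * T => u z.1 z.2) ->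
  measurable_fun setT (fun z : borel D * borel T => u z.1 z.2).
Proof.
move=> [BD cD [oD nD]] [BT cT [oT nT]] cu.
apply: (measurability _ (RGenOpens.measurableE R)).
move=> _ [_ [a [b ->] <-]]; rewrite setTI.
set O := (X in measurable X).
have oO : open (O : set (D * T)).
  by apply: (@open_comp (D * T)%type R) => // *; exact: cu.
pose I := [set W : set D * set T | [/\ BD W.1, BT W.2 & W.1 `*` W.2 `<=` O]].
have -> : O = \bigcup_(W in I) (W.1 `*` W.2).
  apply/seteqP; split => [[x y] Oxy|z [W [_ _ WO]] /WO//].
  have [[U V] /= [Ux Vy] UVO] : nbhs (x, y) O by exact: open_nbhs_nbhs.
  have [U' [BU' U'x] U'U] := nD _ _ Ux.
  have [V' [BV' V'y] V'V] := nT _ _ Vy.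
  exists (U', V') => //; split => //= -[p q] [/= /U'U Up /V'V Vq].
  by apply: UVO.
have cI : countable I.
  apply: (sub_countable _ (countableX cD cT)); apply: subset_card_le.
  by move=> [U V] [].
rewrite bigcup_set_type; apply: countable_bigcupT_measurable.
  by rewrite (eq_countable (card_setT _)).
move=> [[U V] /set_mem[/= /oD oU /oT oV _]] /=.
by apply: measurableX; exact: sub_sigma_algebra.
Qed.

(** * Measures given by a density *)

Section density_measure.
Context {d} {T : measurableType d} {R : realType}.
Variables (mu : {measure set T -> \bar R}) (p : T -> R).

(** The proofs [mp] and [p0] are arguments so that the measure structure below can be attached to
    the term itself. *)
Definition density_measure (mp : measurable_fun setT p)
    (p0 : forall x, 0 <= p x) (B : set T) : \bar R :=
  (\int[mu]_(x in B) (p x)%:E)%E.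

Variables (mp : measurable_fun setT p) (p0 : forall x, 0 <= p x).

Let density_measure0 : density_measure mp p0 set0 = 0%E.
Proof. by rewrite /density_measure integral_set0. Qed.

Let density_measure_ge0 B : (0 <= density_measure mp p0 B)%E.
Proof. by apply: integral_ge0 => x _; rewrite lee_fin. Qed.

Let density_measure_additive : semi_sigma_additive (density_measure mp p0).
Proof.
move=> F mF tF mUF; rewrite /density_measure ge0_integral_bigcup//=.
- by apply: is_cvg_ereal_nneg_natsum => n _; exact: density_measure_ge0.
- by apply/measurable_EFinP; exact: measurable_funTS.
- by move=> x _; rewrite lee_fin.
Qed.

HB.instance Definition _ := isMeasure.Build _ _ _ (density_measure mp p0)
  density_measure0 density_measure_ge0 density_measure_additive.

Let measurable_Ep : measurable_fun setT (EFin \o p).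
Proof. exact/measurable_EFinP. Qed.

Import HBNNSimple.

(** The identity holds for indicators by definition, for simple functions by linearity, and passes
    to the limit by monotone convergence on both sides along [nnsfun_approx]. *)
Lemma ge0_integral_density_measure (f : T -> \bar R) :
  measurable_fun setT f -> (forall x, 0 <= f x)%E ->
  (\int[density_measure mp p0]_x f x = \int[mu]_x ((p x)%:E * f x))%E.
Proof.
move=> mf f0.
pose f_ := nnsfun_approx measurableT mf.
transitivity (limn (fun n => \int[density_measure mp p0]_x (f_ n x)%:E)%E).
  rewrite -monotone_convergence//=.
  - apply: eq_integral => x _; apply/esym/cvg_lim => //.
    exact: cvg_nnsfun_approx.
  - by move=> n; exact/measurable_EFinP.
  - by move=> n x _; rewrite lee_fin.
  - by move=> x _ m n mn; rewrite lee_fin; exact/lefP/nd_nnsfun_approx.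
transitivity (limn (fun n => \int[mu]_x ((p x)%:E * (f_ n x)%:E))%E); last first.
  rewrite -monotone_convergence//=.
  - apply: eq_integral => x _; apply/cvg_lim => //; apply: cvgeZl => //.
    exact: cvg_nnsfun_approx.
  - move=> n; apply: emeasurable_funM => //; exact/measurable_EFinP.
  - by move=> n x _; rewrite mule_ge0// lee_fin.
  - move=> x _ m n mn; rewrite lee_wpmul2l ?lee_fin//.
    exact/lefP/nd_nnsfun_approx.
congr (limn _); apply/funext => n /=.
transitivity (\sum_(r \in range (f_ n))
    \int[density_measure mp p0]_x (r * \1_(f_ n @^-1` [set r]) x)%:E)%E.
  rewrite -ge0_integral_fsum//.
  - by apply: eq_integral => x _; rewrite fimfunE -fsumEFin.
  - by move=> r; exact/measurable_EFinP/measurable_funM.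
  - by move=> r x _; rewrite nnfun_muleindic_ge0.
transitivity (\sum_(r \in range (f_ n))
    \int[mu]_x ((p x)%:E * (r * \1_(f_ n @^-1` [set r]) x)%:E))%E.
  apply: eq_fsbigr => r _; rewrite integralZl_indic_nnsfun// integral_indic//=.
  rewrite setIT.
  (* Pulling r out of a nonnegative integral needs [0 <= r]; for negative r the level set is empty
     and both sides vanish. *)
  have [r0|r0] := ltP r 0.
    rewrite preimage_nnfun0// measure0 mule0 integral0_eq// => x _.
    by rewrite indic0 mulr0 mule0.
  under eq_integral do rewrite EFinM muleCA.
  rewrite ge0_integralZl//.
  - congr (_ * _)%E; rewrite /density_measure integral_mkcond.
    by apply: eq_integral => x _; rewrite epatch_indic.
  - apply: emeasurable_funM => //; exact/measurable_EFinP.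
  - by move=> x _; rewrite mule_ge0// lee_fin.
rewrite -ge0_integral_fsum//.
- apply: eq_integral => x _; rewrite fimfunE -fsumEFin//.
  by rewrite ge0_mule_fsumr// => r; rewrite nnfun_muleindic_ge0.
- move=> r; apply: emeasurable_funM => //.
  by apply/measurable_EFinP/measurable_funM.
- move=> r x _; apply: mule_ge0; first by rewrite lee_fin.
  exact: nnfun_muleindic_ge0.
Qed.

End density_measure.

(** * The Metropolis-Hastings kernel for a proposal density [q] and an acceptance probability
    [al] *)

Section metropolis_hastings.
Context {d} {S : measurableType d} {R : realType}.
Variables (m : {sigma_finite_measure set S -> \bar R}) (q al : S -> S -> R).
Hypothesis mq : measurable_fun setT (fun z : S * S => q z.1 z.2).
Hypothesis q0 : forall x y, 0 <= q x y.
Hypothesis q1 : forall x, (\int[m]_y (q x y)%:E = 1)%E.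
Hypothesis mal : measurable_fun setT (fun z : S * S => al z.1 z.2).
Hypothesis al01 : forall x y, 0 <= al x y <= 1.

Let al0 x y : 0 <= al x y. Proof. by case/andP: (al01 x y). Qed.
Let al1 x y : 0 <= 1 - al x y.
Proof. by rewrite subr_ge0; case/andP: (al01 x y). Qed.

Let mal1 : measurable_fun setT (fun z : S * S => 1 - al z.1 z.2).
Proof. exact: measurable_funB. Qed.

Let acc (z : S * S) := q z.1 z.2 * al z.1 z.2.
Let rej (z : S * S) := q z.1 z.2 * (1 - al z.1 z.2).
Let acc0 z : 0 <= acc z. Proof. exact: mulr_ge0. Qed.
Let rej0 z : 0 <= rej z. Proof. exact: mulr_ge0. Qed.
Let macc : measurable_fun setT acc. Proof. exact: measurable_funM. Qed.
Let mrej : measurable_fun setT rej. Proof. exact: measurable_funM. Qed.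

Let measurable_indic1 B : measurable B ->
  measurable_fun setT (fun z : S * S => \1_B z.1 : R).
Proof. by move=> mB; apply: measurableT_comp => //; exact: measurable_indic. Qed.

Let measurable_indic2 B : measurable B ->
  measurable_fun setT (fun z : S * S => \1_B z.2 : R).
Proof. by move=> mB; apply: measurableT_comp => //; exact: measurable_indic. Qed.

Let measurable_slice (f : S * S -> R) x :
  measurable_fun setT f -> measurable_fun setT (fun y => f (x, y)).
Proof. by move=> mf; exact: measurableT_comp. Qed.

Let integrand B (z : S * S) :=
  q z.1 z.2 * (al z.1 z.2 * \1_B z.2 + (1 - al z.1 z.2) * \1_B z.1).

Let integrandE B z : integrand B z = acc z * \1_B z.2 + rej z * \1_B z.1.
Proof. by rewrite /integrand mulrDr !mulrA. Qed.

Let measurable_integrand B : measurable B -> measurable_fun setT (integrand B).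
Proof.
move=> mB; rewrite (funext (integrandE B)).
apply: measurable_funD; apply: measurable_funM => //.
- exact: measurable_indic2.
- exact: measurable_indic1.
Qed.

Let integrand_ge0 B z : 0 <= integrand B z.
Proof. by rewrite integrandE addr_ge0// mulr_ge0. Qed.

(** The rejected density is dominated by [q], which integrates to 1. Finiteness is what allows the
    rejected mass to serve as a real coefficient of a Dirac measure. *)
Let int_rej x : (\int[m]_y (rej (x, y))%:E \is a fin_num)%E.
Proof.
rewrite ge0_fin_numE; last by apply: integral_ge0 => y _; rewrite lee_fin.
apply: (@le_lt_trans _ _ 1%E); last by rewrite ltry.
rewrite -(q1 x); apply: ge0_le_integral => //.
- by move=> y _; rewrite lee_fin.
- exact/measurable_EFinP/measurable_slice.
- exact/measurable_EFinP/(measurable_slice _ x mq).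
- move=> y _; rewrite lee_fin /rej ler_piMr// lerBlDr lerDl//.
Qed.

(** For fixed x the formula is the sum of two measures: the one with density [acc (x, y)] in y, and
    an atom at x carrying the rejected mass. Tonelli gives measurability in x, and the total mass is
    1 because the acceptance and rejection weights add up to 1 under [q]. *)
Lemma metropolis_hastings_kernel : exists K : R.-pker S ~> S,
  forall x B, measurable B -> K x B = (\int[m]_y
    (q x y * (al x y * \1_B y + (1 - al x y) * \1_B x))%:E)%E.
Proof.
have fr0 x : 0 <= fine (\int[m]_y (rej (x, y))%:E)%E.
  by apply: fine_ge0; apply: integral_ge0 => y _; rewrite lee_fin.
pose K0 x : {measure set S -> \bar R} := measure_add
  (density_measure m _ (measurable_slice _ x macc) (fun y => acc0 (x, y)))
  (mscale (NngNum (fr0 x)) (dirac x)).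
have K0E x B : measurable B -> K0 x B = (\int[m]_y (integrand B (x, y))%:E)%E.
  move=> mB; rewrite [LHS](_ : _ = \int[m]_(y in B) (acc (x, y))%:E +
    (\int[m]_y (rej (x, y))%:E) * \d_x B)%E; last first.
    by rewrite -[in RHS](fineK (int_rej x)); exact: measure_addE.
  under [RHS]eq_integral do rewrite integrandE EFinD.
  rewrite ge0_integralD//.
  - congr (_ + _)%E.
      rewrite [LHS]integral_mkcond; apply: eq_integral => y _.
      by rewrite epatch_indic.
    under [RHS]eq_integral do rewrite EFinM muleC/=.
    rewrite ge0_integralZl//= ?lee_fin//.
    + by rewrite muleC diracE indicE.
    + exact/measurable_EFinP/measurable_slice.
    + by move=> y _; rewrite lee_fin.
  - by move=> y _; rewrite lee_fin mulr_ge0.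
  - apply/measurable_EFinP/measurable_funM; first exact: measurable_slice.
    exact: measurable_indic.
  - by move=> y _; rewrite lee_fin mulr_ge0.
  - apply/measurable_EFinP/measurable_funM; first exact: measurable_slice.
    exact: (measurable_cst (\1_B x : R)).
have mK0 B : measurable B -> measurable_fun setT (K0 ^~ B).
  move=> mB; rewrite (funext (fun x => K0E x B mB)).
  apply: (measurable_fun_fubini_tonelli_F (EFin \o integrand B)).
    by apply/measurable_EFinP; exact: measurable_integrand.
  by move=> z; rewrite lee_fin.
have K01 x : K0 x setT = 1%E.
  rewrite K0E// -[RHS](q1 x); apply: eq_integral => y _.
  by rewrite /integrand/= !indicT !mulr1 addrC subrK mulr1.
pose kK0 := isKernel.Build _ _ _ _ _ K0 mK0.
pose K1 : R.-ker S ~> S := HB.pack K0 kK0.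
pose K2 : R.-pker S ~> S :=
  HB.pack K0 kK0 (Kernel_isProbability.Build _ _ _ _ _ K1 K01).
by exists K2 => x B mB; exact: K0E.
Qed.

Lemma metropolis_hastings_stationary (p : S -> R) B :
  measurable_fun setT p -> (forall x, 0 <= p x) ->
  (forall x y, p x * (q x y * al x y) = p y * (q y x * al y x)) ->
  measurable B ->
  (\int[m]_x ((p x)%:E * \int[m]_y
     (q x y * (al x y * \1_B y + (1 - al x y) * \1_B x))%:E) =
   \int[m]_(x in B) (p x)%:E)%E.
Proof.
move=> mp p0 balance mB.
(* For moves from z.1 towards z.2 with initial density [p]: [F] counts accepted moves ending in B,
   [G] rejected moves made in B, and [F'] accepted moves starting in B. *)
pose F (z : S * S) := (p z.1 * acc z * \1_B z.2)%:E.
pose G (z : S * S) := (p z.1 * rej z * \1_B z.1)%:E.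
pose F' (z : S * S) := (p z.1 * acc z * \1_B z.1)%:E.
have mp1 : measurable_fun setT (fun z : S * S => p z.1).
  exact: measurableT_comp.
have mF : measurable_fun setT F.
  apply/measurable_EFinP/measurable_funM; first exact: measurable_funM.
  exact: measurable_indic2.
have mG : measurable_fun setT G.
  apply/measurable_EFinP/measurable_funM; first exact: measurable_funM.
  exact: measurable_indic1.
have mF' : measurable_fun setT F'.
  apply/measurable_EFinP/measurable_funM; first exact: measurable_funM.
  exact: measurable_indic1.
have F0 z : (0 <= F z)%E by rewrite lee_fin mulr_ge0// mulr_ge0.
have G0 z : (0 <= G z)%E by rewrite lee_fin mulr_ge0// mulr_ge0.
have F'0 z : (0 <= F' z)%E by rewrite lee_fin mulr_ge0// mulr_ge0.
have esection (f : S * S -> \bar R) x :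
    measurable_fun setT f -> measurable_fun setT (fun y => f (x, y)).
  by move=> mf; exact: measurableT_comp.
have iD (f g : S * S -> \bar R) : measurable_fun setT f ->
    measurable_fun setT g -> (forall z, 0 <= f z)%E -> (forall z, 0 <= g z)%E ->
    (\int[m]_x \int[m]_y (f (x, y) + g (x, y)) =
     \int[m]_x \int[m]_y f (x, y) + \int[m]_x \int[m]_y g (x, y))%E.
  move=> mf mg f0 g0; rewrite -ge0_integralD//.
  - by apply: eq_integral => x _; rewrite ge0_integralD//; exact: esection.
  - by move=> x _; exact: integral_ge0.
  - exact: (measurable_fun_fubini_tonelli_F f).
  - by move=> x _; exact: integral_ge0.
  - exact: (measurable_fun_fubini_tonelli_F g).
transitivity (\int[m]_x \int[m]_y (F (x, y) + G (x, y)))%E.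
  apply: eq_integral => x _; rewrite -ge0_integralZl ?lee_fin//.
  - apply: eq_integral => y _; rewrite -EFinM -EFinD; congr EFin.
    by rewrite /acc /rej/= mulrDr mulrDr !mulrA.
  - apply/measurable_EFinP.
    exact: (measurable_slice _ x (measurable_integrand B mB)).
  - by move=> y _; rewrite lee_fin (integrand_ge0 B (x, y)).
(* The accepted flow into B equals the accepted flow out of B, which together
   with the rejected mass adds up to the mass of B. *)
rewrite iD// (fubini_tonelli F)//.
(* After the exchange of integrals the end point is the outer variable; [balance] turns it into the
   starting point. *)
have -> : (\int[m]_y \int[m]_x F (x, y) = \int[m]_x \int[m]_y F' (x, y))%E.
  apply: eq_integral => y _; apply: eq_integral => x _.
  by rewrite /F /F' /acc/= balance.
rewrite -iD// [RHS]integral_mkcond; apply: eq_integral => x _.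
transitivity (\int[m]_y ((p x * \1_B x)%:E * (q x y)%:E))%E.
  apply: eq_integral => y _; rewrite -EFinM -EFinD; congr EFin.
  rewrite /acc /rej/= -mulrDl -mulrDr -mulrDr addrC subrK mulr1.
  by rewrite mulrAC.
rewrite ge0_integralZl//.
- by rewrite q1 mule1 epatch_indic.
- exact/measurable_EFinP/(measurable_slice _ x mq).
- by move=> y _; rewrite lee_fin.
- by rewrite lee_fin mulr_ge0.
Qed.

End metropolis_hastings.

(** * Auxiliary facts: acceptance ratios, positive integrals, product measures *)

Lemma mul_min1_div (R : realFieldType) (a b : R) : 0 <= a -> 0 <= b ->
  a * Num.min 1 (b / a) = Num.min a b.
Proof.
(* When a = 0 both sides are 0, whatever value division by zero takes. *)
rewrite le_eqVlt => /predU1P[<- b0|a0 b0]; first by rewrite mul0r min_l.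
by rewrite minr_pMr ?ltW// mulr1 mulrC divfK// gt_eqF.
Qed.

(** A zero integral would force f to vanish almost everywhere; as f vanishes nowhere, the whole
    space would lie in a null set. *)
Lemma integral_gt0 d (T : measurableType d) (R : realType)
    (mu : {measure set T -> \bar R}) (f : T -> \bar R) :
  measurable_fun setT f -> (forall x, 0 < f x)%E -> (0 < mu setT)%E ->
  (0 < \int[mu]_x f x)%E.
Proof.
move=> mf f0 mu0; rewrite lt0e integral_ge0 ?andbT => [|x _]; last exact: ltW.
apply/eqP => If0.
have : (\int[mu]_x `|f x| = 0)%E.
  by rewrite -[RHS]If0; apply: eq_integral => x _; rewrite gee0_abs// ltW.
move/(ae_eq_integral_abs mu measurableT mf) => [N [mN N0 sN]].
suff : (mu setT <= mu N)%E by rewrite N0 leNgt mu0.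
apply: le_measure; rewrite ?inE// => x _; apply: sN => /= /(_ I) fx0.
by have := f0 x; rewrite fx0 ltxx.
Qed.

(* The library's own sigma-finite instance is shadowed by the one for
   products of subprobabilities. *)
Definition sigma_finite_product (R : realType) d1 d2 (T1 : measurableType d1)
    (T2 : measurableType d2) (m1 : {sigma_finite_measure set T1 -> \bar R})
    (m2 : {sigma_finite_measure set T2 -> \bar R}) :
    {sigma_finite_measure set (T1 * T2)%type -> \bar R} :=
  HB.pack (m1 \x m2)%E
    (lebesgue_integral_fubini.measure_function_Measure_isSigmaFinite__to__measure_function_isSigmaFinite m1 m2)
    (lebesgue_integral_fubini.measure_function_Measure_isSigmaFinite__to__measure_function_isSFinite m1 m2).

(** * DAPS as an instance of Metropolis-Hastings *)

Section daps.
Context {R : realType} {D A Th : ptopologicalType}.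
Variables (scD : @second_countable D) (scTh : @second_countable Th).
Variables (muD : {sigma_finite_measure set (borel D) -> \bar R})
  (law : probability (borel A) R)
  (muTh : {sigma_finite_measure set (borel Th) -> \bar R})
  (uD : D -> Th -> R) (pD : D -> A -> Th -> R) (gD : D -> D -> R).
Hypothesis uD_pos : forall d t, 0 < uD d t.
Hypothesis uD_cont : continuous (fun z : D * Th => uD z.1 z.2).
Hypothesis pD_meas : measurable_fun setT
  (fun z : borel D * borel A * borel Th => pD z.1.1 z.1.2 z.2).
Hypothesis pD_pos : forall d a t, 0 < pD d a t.
Hypothesis pD_dens : forall d a, is_density muTh (pD d a : borel Th -> R).
Hypothesis gD_meas : measurable_fun setT
  (fun z : borel D * borel D => gD z.1 z.2).
Hypothesis gD_dens : forall d, is_density muD (gD d : borel D -> R).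

Local Notation S := (borel D * borel A * borel Th)%type.

Let mDA := sigma_finite_product R _ _ _ _ muD law.

(** This is convertible to [aug_ref] and carries the sigma-finite structure required by Tonelli and
    by the general Metropolis-Hastings lemmas. *)
Let m : {sigma_finite_measure set S -> \bar R} :=
  sigma_finite_product R _ _ _ _ mDA muTh.

(** The draw of the attack contributes no factor, since its law is part of the reference measure
    [m]. *)
Let q (x y : S) : R := gD x.1.1 y.1.1 * pD y.1.1 y.1.2 y.2.

Let gD_ge0 d d' : 0 <= gD d d'. Proof. by case: (gD_dens d). Qed.

Let pD_ge0 d a t : 0 <= pD d a t. Proof. exact: ltW. Qed.

Lemma integral_aug_ref (f : S -> \bar R) :
  measurable_fun setT f -> (forall x, 0 <= f x)%E ->
  (\int[aug_ref muD law muTh]_x f x =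
   \int[muD]_d \int[law]_a \int[muTh]_t f (d, a, t))%E.
Proof.
move=> mf f0.
(* Tonelli is applied once per product; the second conversion exhibits the inner integral over theta
   as a function on D * A. *)
rewrite -[LHS]/(\int[mDA \x muTh]_x f x)%E fubini_tonelli1//.
rewrite -[LHS]/(\int[muD \x law]_x fubini_F muTh f x)%E fubini_tonelli1//.
  exact: (measurable_fun_fubini_tonelli_F f).
by move=> x; exact: integral_ge0.
Qed.

Let measurable_uD : measurable_fun setT (fun x : S => uD x.1.1 x.2).
Proof.
apply: (@measurableT_comp _ _ _ _ _ _
  (fun z : borel D * borel Th => uD z.1 z.2) _ (fun x : S => (x.1.1, x.2))).
  exact: continuous_measurable_borel_prod.
apply: measurable_fun_pair => //.
by apply: measurableT_comp => //; exact: measurable_fst.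
Qed.

Let measurable_gD d (T : measurableType d) (f g : T -> S) :
  measurable_fun setT f -> measurable_fun setT g ->
  measurable_fun setT (fun x : T => gD (f x).1.1 (g x).1.1).
Proof.
move=> mf mg; apply: (@measurableT_comp _ _ _ _ _ _
  (fun z : borel D * borel D => gD z.1 z.2) _
  (fun x : T => ((f x).1.1, (g x).1.1))) => //.
by apply: measurable_fun_pair; do 2 apply: measurableT_comp => //.
Qed.

Let measurable_q : measurable_fun setT (fun z : S * S => q z.1 z.2).
Proof.
apply: measurable_funM; first exact: measurable_gD.
exact: (@measurableT_comp _ _ _ _ _ _
  (fun z : S => pD z.1.1 z.1.2 z.2) _ snd).
Qed.

Let measurable_accept :
  measurable_fun setT (fun z : S * S => daps_accept uD gD z.1 z.2).
Proof.
have muDc (f : S * S -> S) : measurable_fun setT f ->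
    measurable_fun setT (fun z => uD (f z).1.1 (f z).2).
  by move=> mf; exact: (measurableT_comp measurable_uD mf).
apply: measurable_minr; first exact: measurable_cst.
apply: measurable_div; apply: measurable_funM.
- exact: muDc.
- exact: measurable_gD.
- exact: muDc.
- exact: measurable_gD.
Qed.

Let accept01 (x y : S) : 0 <= daps_accept uD gD x y <= 1.
Proof.
rewrite /daps_accept ge_min lexx/= andbT le_min ler01/=.
by rewrite divr_ge0// mulr_ge0// ltW.
Qed.

Let integral_prob_const (c : \bar R) : (\int[law]_a cst c a = c)%E.
Proof.
rewrite integral_cst// -[RHS]mule1; congr (_ * _)%E.
exact: (probability_setT law).
Qed.

(** Moving the factor [gD] inside the integrals over a and theta turns the successive draws of the
    algorithm into a single density [q] against [m], the form used by the general lemmas. *)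
Lemma proposal_meanE (x : S) (f : S -> R) :
  measurable_fun setT f -> (forall y, 0 <= f y) ->
  proposal_mean muD law muTh pD gD x f =
  (\int[m]_y (q x y * f y)%:E)%E.
Proof.
move=> mf f0; have mpf : measurable_fun setT
    (fun y : S => (pD y.1.1 y.1.2 y.2 * f y)%:E).
  exact/measurable_EFinP/measurable_funM.
have pf0 (y : S) : (0 <= (pD y.1.1 y.1.2 y.2 * f y)%:E)%E.
  by rewrite lee_fin mulr_ge0.
rewrite [RHS]integral_aug_ref; last 2 first.
- apply/measurable_EFinP/measurable_funM => //.
  exact: (measurableT_comp measurable_q (pair1_measurable x)).
- by move=> y; rewrite lee_fin !mulr_ge0.
apply: eq_integral => d _.
have mt a : measurable_fun setT
    (fun t : borel Th => (pD d a t * f (d, a, t))%:E).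
  have mda : measurable_fun setT (pair (d, a) : borel Th -> S).
    exact: (pair1_measurable ((d, a) : borel D * borel A)).
  exact: (measurableT_comp mpf mda).
have ma : measurable_fun setT (fun a : borel A =>
    \int[muTh]_t (pD d a t * f (d, a, t))%:E)%E.
  have md : measurable_fun setT (pair d : borel A -> borel D * borel A).
    exact: (pair1_measurable (d : borel D)).
  exact: (measurableT_comp
    (measurable_fun_fubini_tonelli_F (m2 := muTh) _ mpf pf0) md).
rewrite -ge0_integralZl ?lee_fin//; last first.
  by move=> a _; apply: integral_ge0 => t _; exact: (pf0 (d, a, t)).
apply: eq_integral => a _; rewrite -ge0_integralZl ?lee_fin//.
- by apply: eq_integral => t _; rewrite -EFinM mulrA.
- by move=> t _; exact: (pf0 (d, a, t)).
Qed.

Let q_ge0 (x y : S) : 0 <= q x y. Proof. exact: mulr_ge0. Qed.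

Let integral_q (x : S) : (\int[m]_y (q x y)%:E = 1)%E.
Proof.
(* In iterated form the draws integrate to 1 one after the other: theta, then a, then d. *)
transitivity (proposal_mean muD law muTh pD gD x (cst 1)).
  rewrite proposal_meanE//; apply: eq_integral => y _.
  by rewrite /= mulr1.
have [_ _ <-] := gD_dens x.1.1; apply: eq_integral => d _.
rewrite (_ : \int[law]_a _ = 1)%E ?mule1//.
rewrite -[RHS](integral_prob_const 1%E); apply: eq_integral => a _ /=.
have [_ _ <-] := pD_dens d a; apply: eq_integral => t _ /=.
by rewrite mulr1.
Qed.

(** The boolean is the decision recorded in [daps_draw], so that acceptance and rejection are
    handled together. *)
Let measurable_mix (b : bool) : measurable_fun setT (fun z : S * S =>
  if b then daps_accept uD gD z.1 z.2 else 1 - daps_accept uD gD z.1 z.2).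
Proof. by case: b => //; exact: measurable_funB. Qed.

Let mix_ge0 (b : bool) (x y : S) :
  0 <= if b then daps_accept uD gD x y else 1 - daps_accept uD gD x y.
Proof. by have /andP[? ?] := accept01 x y; case: b; rewrite ?subr_ge0. Qed.

Let measurable_mix_at (b : bool) (x : S) : measurable_fun setT (fun y : S =>
  if b then daps_accept uD gD x y else 1 - daps_accept uD gD x y).
Proof. exact: (measurableT_comp (measurable_mix b) (pair1_measurable x)). Qed.

Lemma measurable_proposal_mean (b : bool) (B : set S) : measurable B ->
  measurable_fun setT (fun x : S => proposal_mean muD law muTh pD gD x
    (fun y => (if b then daps_accept uD gD x y else 1 - daps_accept uD gD x y)
              * \1_B y)).
Proof.
move=> mB.
have -> : (fun x : S => proposal_mean muD law muTh pD gD x (fun y =>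
    (if b then daps_accept uD gD x y else 1 - daps_accept uD gD x y) *
      \1_B y)) = (fun x => \int[m]_y (q x y *
    ((if b then daps_accept uD gD x y else 1 - daps_accept uD gD x y) *
      \1_B y))%:E)%E.
  apply/funext => x; apply: proposal_meanE => [|y]; last by rewrite mulr_ge0.
  by apply: measurable_funM => //; exact: measurable_indic.
apply: (measurable_fun_fubini_tonelli_F (m2 := m) (fun z : S * S => (q z.1 z.2 *
    ((if b then daps_accept uD gD z.1 z.2 else 1 - daps_accept uD gD z.1 z.2) *
      \1_B z.2))%:E)).
  apply/measurable_EFinP/measurable_funM => //; apply: measurable_funM => //.
  by apply: measurableT_comp => //; exact: measurable_indic.
by move=> z; rewrite lee_fin !mulr_ge0.
Qed.

Lemma daps_transitionE (x : S) (B : set S) : measurable B ->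
  daps_transition muD law muTh uD pD gD x B =
  (\int[m]_y (q x y * (daps_accept uD gD x y * \1_B y +
                       (1 - daps_accept uD gD x y) * \1_B x))%:E)%E.
Proof.
move=> mB; apply: proposal_meanE => [|y].
  apply: measurable_funD; apply: measurable_funM.
  - exact: (measurable_mix_at true x).
  - exact: measurable_indic.
  - exact: (measurable_mix_at false x).
  - exact: measurable_cst.
by rewrite addr_ge0// mulr_ge0//; [exact: (mix_ge0 true)|exact: (mix_ge0 false)].
Qed.

(** The two terms are the shapes that [daps_draw] produces: an accepted proposal must fall in B,
    whereas a rejected one may be anywhere provided the current state is in B. *)
Lemma daps_transition_split (x : S) (B : set S) : measurable B ->
  daps_transition muD law muTh uD pD gD x B =
  (proposal_mean muD law muTh pD gD x
     (fun y => (daps_accept uD gD x y * \1_B y)%R) +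
   (\1_B x)%:E * proposal_mean muD law muTh pD gD x
     (fun y => ((1 - daps_accept uD gD x y) * \1_[set: S] y)%R))%E.
Proof.
move=> mB; rewrite daps_transitionE//.
have mq1 := measurableT_comp measurable_q (pair1_measurable x).
have mxb b (C : set S) : measurable C -> measurable_fun setT (fun y : S =>
    (if b then daps_accept uD gD x y else 1 - daps_accept uD gD x y) * \1_C y).
  by move=> mC; apply: measurable_funM => //; exact: measurable_indic.
have [mt mf] := (mxb true _ mB, mxb false _ measurableT).
have mt0 y : 0 <= daps_accept uD gD x y * \1_B y.
  by rewrite mulr_ge0// (mix_ge0 true).
have mf0 y : 0 <= (1 - daps_accept uD gD x y) * \1_[set: S] y.
  by rewrite mulr_ge0// (mix_ge0 false).
rewrite !proposal_meanE// -ge0_integralZl ?lee_fin//.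
- rewrite -ge0_integralD//.
  + apply: eq_integral => y _; rewrite -EFinM -EFinD; congr EFin.
    by rewrite indicT/= mulr1 mulrDr; congr (_ + _); rewrite mulrA mulrC.
  + by move=> y _; rewrite lee_fin mulr_ge0.
  + exact/measurable_EFinP/measurable_funM.
  + by move=> y _; rewrite mule_ge0// lee_fin// mulr_ge0.
  + apply: emeasurable_funM => //; exact/measurable_EFinP/measurable_funM.
- exact/measurable_EFinP/measurable_funM.
- by move=> y _; rewrite lee_fin mulr_ge0.
Qed.

Lemma daps_kernel : exists K : R.-pker S ~> S, forall x B, measurable B ->
  K x B = daps_transition muD law muTh uD pD gD x B.
Proof.
have [K KE] := metropolis_hastings_kernel m q _ measurable_q q_ge0 integral_q
  measurable_accept accept01.
by exists K => x B mB; rewrite KE// daps_transitionE.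
Qed.

(** * The augmented distribution: normalization, stationarity and marginal mode *)

Let w (x : S) : R := uD x.1.1 x.2 * pD x.1.1 x.1.2 x.2.

Let w_gt0 x : 0 < w x. Proof. exact: mulr_gt0. Qed.

Let measurable_w : measurable_fun setT w. Proof. exact: measurable_funM. Qed.

Let measurable_Ew : measurable_fun setT (EFin \o w).
Proof. exact/measurable_EFinP. Qed.

Let Z : \bar R := aug_const muD law muTh uD pD.

Lemma aug_constE : Z = (\int[muD]_d psiD law muTh uD pD d)%E.
Proof.
by rewrite /Z /aug_const integral_aug_ref// => x; rewrite lee_fin ltW ?mulr_gt0.
Qed.

Lemma measurable_psiD :
  measurable_fun setT (psiD law muTh uD pD : borel D -> \bar R).
Proof.
have w0 x : (0 <= (w x)%:E)%E by rewrite lee_fin ltW.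
apply: (measurable_fun_fubini_tonelli_F (m2 := law)
  (fubini_F muTh (EFin \o w))).
  exact: measurable_fun_fubini_tonelli_F.
by move=> z; apply: integral_ge0 => t _; exact: w0.
Qed.

Lemma psiD_ge0 d : (0 <= psiD law muTh uD pD d)%E.
Proof.
apply: integral_ge0 => a _; apply: integral_ge0 => t _.
by rewrite lee_fin mulr_ge0// ltW.
Qed.

Lemma aug_const_gt0 : (0 < Z)%E.
Proof.
apply: (integral_gt0 _ _ _ m (EFin \o w)) => //.
(* a null reference measure could not carry the probability density q *)
rewrite lt0e measure_ge0 andbT; apply/eqP => m0.
have mq := measurableT_comp measurable_q (pair1_measurable (point : S)).
have : (\int[m]_y `|(q point y)%:E| = 1)%E.
  by rewrite -(integral_q point); apply: eq_integral => y _;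
    rewrite gee0_abs// lee_fin.
rewrite integral_abs_eq0//; last exact/measurable_EFinP.
by move/eqP; rewrite eq_sym onee_eq0.
Qed.

Hypothesis muD_fin : (muD setT < +oo)%E.
Hypothesis psi_fin : forall d, (psiD law muTh uD pD d < +oo)%E.
Variable dARA : D.
Hypothesis dARA_opt : argmax (psiD law muTh uD pD) dARA.

(** The integrand in d is bounded by its value at the maximizer [dARA], finite by [psi_fin], and a
    constant has a finite integral against the finite measure [muD]. *)
Lemma aug_const_lty : (Z < +oo)%E.
Proof.
rewrite aug_constE; apply: (@le_lt_trans _ _
  (\int[muD]_d cst (psiD law muTh uD pD dARA) d)%E).
  apply: ge0_le_integral => //.
    by move=> d _; exact: psiD_ge0.
  exact: measurable_psiD.
rewrite integral_cst// lte_mul_pinfty//; first exact: psiD_ge0.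
by rewrite ge0_fin_numE//; exact: psiD_ge0.
Qed.

Let Z_gt0 : 0 < fine Z.
Proof. by apply: fine_gt0; rewrite aug_const_gt0 aug_const_lty. Qed.

(** The density divides by [fine Z]; finiteness of Z ensures that this real number is the true
    normalizing constant and not a default value. *)
Let ZE : (fine Z)%:E = Z.
Proof.
by apply: fineK; rewrite ge0_fin_numE ?aug_const_lty// ltW ?aug_const_gt0.
Qed.

Let p : S -> R := aug_density muD law muTh uD pD.

Let pE x : p x = (fine Z)^-1 * w x.
Proof. by rewrite mulrC. Qed.

Let p_ge0 x : 0 <= p x.
Proof. by rewrite pE; apply: mulr_ge0; rewrite ?invr_ge0 ltW. Qed.

Let measurable_p : measurable_fun setT p.
Proof. by rewrite (funext pE); exact: measurable_funM. Qed.

Let integral_p : (\int[m]_x (p x)%:E = 1)%E.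
Proof.
under eq_integral do rewrite pE EFinM.
rewrite ge0_integralZl ?lee_fin ?invr_ge0 ?ltW//.
  by rewrite -[X in (_ * X)%E]/Z -ZE -EFinM mulVf// gt_eqF.
by move=> x _; rewrite lee_fin ltW.
Qed.

(** Stationarity only involves the values of [K] on measurable sets; keeping [K] abstract lets the
    result apply to the kernel obtained from [daps_kernel]. *)
Lemma aug_probability : exists pi : probability S R,
  (forall B, measurable B ->
     pi B = \int[aug_ref muD law muTh]_(x in B) (p x)%:E)%E /\
  forall K : S -> {measure set S -> \bar R},
    (forall B, measurable B -> measurable_fun setT (K ^~ B)) ->
    (forall x B, measurable B ->
       K x B = daps_transition muD law muTh uD pD gD x B) ->
    stationary K pi.
Proof.
pose pi0 := density_measure m p measurable_p p_ge0.
have pi1 : pi0 setT = 1%E by exact: integral_p.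
pose pi : probability S R :=
  HB.pack pi0 (Measure_isProbability.Build _ _ _ pi0 pi1).
exists pi; split=> [//|K mK KE B mB].
transitivity (\int[m]_x ((p x)%:E * K x B))%E.
  apply: ge0_integral_density_measure => //; exact: mK.
rewrite -[RHS]/(\int[m]_(x in B) (p x)%:E)%E.
rewrite -(metropolis_hastings_stationary m q _ measurable_q q_ge0 integral_q
  measurable_accept accept01 p B)//.
  by apply: eq_integral => x _; rewrite KE// daps_transitionE.
(* What remains is detailed balance for [p]. *)
move=> x y; rewrite !pE /w /q /daps_accept.
set u := uD x.1.1 x.2; set v := uD y.1.1 y.2.
set g := gD x.1.1 y.1.1; set h := gD y.1.1 x.1.1.
set P := pD x.1.1 _ _; set Q := pD y.1.1 _ _.
have u0 : 0 <= u by exact/ltW/uD_pos.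
have v0 : 0 <= v by exact/ltW/uD_pos.
have ug : 0 <= u * g := mulr_ge0 u0 (gD_ge0 _ _).
have vh : 0 <= v * h := mulr_ge0 v0 (gD_ge0 _ _).
(* Grouping u * g with the acceptance probability yields the minimum of u * g and v * h through
   [mul_min1_div]; swapping the arguments and unfolding back gives the other side. *)
transitivity ((fine Z)^-1 * P * Q * (u * g * Num.min 1 (v * h / (u * g)))).
  ring.
rewrite mul_min1_div// minC -mul_min1_div//; ring.
Qed.

Lemma marginal_dE d : marginal_d law muTh p d =
  ((fine Z)^-1%:E * psiD law muTh uD pD d)%E.
Proof.
have w0 x : (0 <= (w x)%:E)%E by rewrite lee_fin ltW.
have Z0 : (0 <= (fine Z)^-1%:E)%E by rewrite lee_fin invr_ge0 ltW.
have mda a : measurable_fun setT (fun t : borel Th => (w (d, a, t))%:E).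
  have mp : measurable_fun setT (pair (d, a) : borel Th -> S).
    exact: (pair1_measurable ((d, a) : borel D * borel A)).
  exact: (measurableT_comp measurable_Ew mp).
have md : measurable_fun setT (fun a : borel A =>
    \int[muTh]_t (w (d, a, t))%:E)%E.
  have mp : measurable_fun setT (pair d : borel A -> borel D * borel A).
    exact: (pair1_measurable (d : borel D)).
  exact: (measurableT_comp
    (measurable_fun_fubini_tonelli_F (m2 := muTh) _ measurable_Ew w0) mp).
rewrite /psiD -ge0_integralZl//; last first.
  by move=> a _; apply: integral_ge0 => t _; exact: (w0 (d, a, t)).
apply: eq_integral => a _; rewrite /psiDA -ge0_integralZl//.
- by apply: eq_integral => t _; rewrite pE EFinM.
- exact: mda.
- by move=> t _; exact: (w0 (d, a, t)).
Qed.

(** The marginal is [psiD] scaled by a nonnegative constant, which preserves the order of its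
    values. *)
Lemma argmax_marginal_d : argmax (marginal_d law muTh p) dARA.
Proof.
move=> d; rewrite !marginal_dE lee_wpmul2l//.
by rewrite lee_fin invr_ge0 ltW.
Qed.

(** * The Markov property of a run *)

Section run.
Context {disp : measure_display} {W : measurableType disp}.
Variables (P : probability W R) (X Y : nat -> W -> S) (acc : nat -> W -> bool).
Variable (d0 : D).
Hypothesis run : daps_run muD law muTh uD pD gD d0 P X Y acc.

Let past_measurable n E : past X n E -> measurable E.
Proof.
apply: smallest_sub; first exact: sigma_algebra_measurable.
move=> _ [i _ [B mB <-]]; exact: (daps_measX run).
Qed.

(** On rejection the next state is the current one, so the condition that it lies in B belongs to
    the past and can be absorbed into the event given to [daps_draw]. *)
Let past_setI n E B : past X n E -> measurable B ->
  past X n (E `&` X n @^-1` B).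
Proof.
move=> pastE mB.
have pB : past X n (X n @^-1` B).
  apply: sub_sigma_algebra; exists n; first exact: ltnSn.
  by exists B => //; rewrite setTI.
exact: (@measurableI _ (g_sigma_algebraType _) _ _ pastE pB).
Qed.

(** The event that the next state lies in B splits according to the decision: accepted with [Y n] in
    B, or rejected with [X n] in B. [daps_draw] evaluates each piece, and [daps_transition_split]
    recombines them. *)
Lemma daps_run_markov (K : S -> {measure set S -> \bar R}) :
  (forall x B, measurable B ->
     K x B = daps_transition muD law muTh uD pD gD x B) ->
  markov_chain P K X.
Proof.
move=> KE; split; first exact: (daps_measX run).
move=> n E B pastE mB; have mE := past_measurable _ _ pastE.
pose E' := E `&` X n @^-1` B.
have pastE' : past X n E' by exact: past_setI.
have mset (C : set S) b : measurable C ->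
    measurable [set w | C (Y n w) /\ acc n w = b].
  move=> mC; apply: (@measurableI _ _ (Y n @^-1` C) (acc n @^-1` [set b])).
    by rewrite -[X in measurable X]setTI; exact: (daps_measY run).
  by rewrite -[X in measurable X]setTI; exact: (daps_measacc run).
have -> : E `&` X n.+1 @^-1` B =
    (E `&` [set w | B (Y n w) /\ acc n w = true]) `|`
    (E' `&` [set w | [set: S] (Y n w) /\ acc n w = false]).
  apply/seteqP; split => [t [Et]|t].
    rewrite /= (daps_step run); case: ifP => at_ Bt; first by left.
    by right.
  by case=> [[Et [Bt at_]]|[[Et Bt] [_ at_]]]; split=> //=;
    rewrite (daps_step run) at_.
have mE' := past_measurable _ _ pastE'.
rewrite measureU; last 3 first.
- by apply: measurableI => //; exact: mset.
- by apply: measurableI => //; exact: mset.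
- apply/seteqP; split => // t [[_ [_ t1]] [_ [_ t2]]].
  by move: t1; rewrite t2.
have D1 := daps_draw run true pastE mB.
have D2 := daps_draw run false pastE' (@measurableT _ S).
apply: etrans.
  exact: (f_equal2 (fun a b => a + b)%E D1 D2).
have mH b (C : set S) (mC : measurable C) :=
  measurableT_comp (measurable_proposal_mean b C mC) (daps_measX run n).
have H0 b (C : set S) (x : S) : measurable C ->
  (0 <= proposal_mean muD law muTh pD gD x (fun y =>
    ((if b then daps_accept uD gD x y else 1 - daps_accept uD gD x y) *
    \1_C y)%R))%E.
  move=> mC; rewrite proposal_meanE.
  - by apply: integral_ge0 => y _; rewrite lee_fin !mulr_ge0.
  - by apply: measurable_funM => //; exact: measurable_indic.
  - by move=> y; rewrite mulr_ge0.
(* Restricting the second integral to [X n] in B becomes the indicator factor of the rejection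
   term. *)
rewrite [X in (_ + X)%E]integral_mkcondr -ge0_integralD//.
- apply: eq_integral => t _; rewrite KE// daps_transition_split//.
  by rewrite epatch_indic/= [in RHS]muleC.
- by move=> t _; exact: (H0 true).
- by apply: measurable_funTS; exact: (mH true).
- move=> t _; rewrite epatch_indic; apply: mule_ge0; last by rewrite lee_fin.
  exact: (H0 false _ _ measurableT).
- apply: measurable_funTS; rewrite epatch_indic; apply: emeasurable_funM.
    exact: (mH false _ measurableT).
  apply/measurable_EFinP; apply: measurable_indic.
  by rewrite -[X in measurable X]setTI; exact: (daps_measX run).
Qed.

End run.
End daps.

(** * Stationarity of the augmented distribution and convergence to the Defender's optimum *)

Theorem proposition1 (R : realType) (D A Th : ptopologicalType)
  (scD : @second_countable D) (scA : @second_countable A)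
  (scTh : @second_countable Th)
  (muD : {sigma_finite_measure set (borel D) -> \bar R})
  (muA : {sigma_finite_measure set (borel A) -> \bar R})
  (muTh : {sigma_finite_measure set (borel Th) -> \bar R})
  (muDK : forall K : set D, compact K -> (muD K < +oo)%E)
  (* Defender's model *)
  (uD : D -> Th -> R) (pD : D -> A -> Th -> R)
  (pD_meas : measurable_fun setT
     (fun z : borel D * borel A * borel Th => pD z.1.1 z.1.2 z.2))
  (pD_dens : forall d a, is_density muTh (pD d a : borel Th -> R))
  (* Attacker's random model *)
  (disp : measure_display) (Omega : measurableType disp)
  (Pr : probability Omega R)
  (UA : Omega -> A -> Th -> R) (PAth : Omega -> D -> A -> Th -> R)
  (PAd : Omega -> D -> R)
  (UA_meas : measurable_fun setT
     (fun z : Omega * borel A * borel Th => UA z.1.1 z.1.2 z.2))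
  (PAth_meas : measurable_fun setT
     (fun z : Omega * borel D * borel A * borel Th =>
        PAth z.1.1.1 z.1.1.2 z.1.2 z.2))
  (PAd_meas : measurable_fun setT (fun z : Omega * borel D => PAd z.1 z.2))
  (PAth_dens : {ae Pr, forall w, forall d a,
     is_density muTh (PAth w d a : borel Th -> R)})
  (PAd_dens : {ae Pr, forall w, is_density muD (PAd w : borel D -> R)})
  (* random optimal attack *)
  (Astar : {RV Pr >-> borel A})
  (Astar_opt : {ae Pr, forall w,
     argmax (attacker_utility muD muTh (UA w) (PAth w) (PAd w)) (Astar w)})
  (* proposals *)
  (gD : D -> D -> R) (gA : A -> A -> R)
  (* Defender's optimum *)
  (psi_fin : forall d, (psiD (distribution Pr Astar) muTh uD pD d < +oo)%E)
  (dARA : D) (dARA_opt : argmax (psiD (distribution Pr Astar) muTh uD pD) dARA)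
  (* 1. *)
  (uD_pos : forall d t, 0 < uD d t)
  (uD_cont : continuous (fun z : D * Th => uD z.1 z.2))
  (UA_pos : {ae Pr, forall w, forall a t, 0 < UA w a t})
  (UA_cont : {ae Pr, forall w, continuous (fun z : A * Th => UA w z.1 z.2)})
  (* 2. *)
  (cptD : compact [set: D]) (cptA : compact [set: A])
  (* 3. *)
  (pD_cont : forall a t, continuous (fun d => pD d a t))
  (PAth_cont : {ae Pr, forall w, forall d t, continuous (fun a => PAth w d a t)})
  (pD_pos : forall d a t, 0 < pD d a t)
  (PAth_pos : {ae Pr, forall w, forall d a t, 0 < PAth w d a t})
  (* 4. *)
  (gD_supp : full_support_proposal muD gD)
  (gA_supp : full_support_proposal muA gA) :
  let pDa : probability (borel A) R := distribution Pr Astar in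
  let piD := aug_density muD pDa muTh uD pD in
  exists (K : R.-pker (borel D * borel A * borel Th)%type
                 ~> (borel D * borel A * borel Th)%type)
         (pi : probability (borel D * borel A * borel Th)%type R),
  [/\ forall x B, measurable B -> K x B = daps_transition muD pDa muTh uD pD gD x B,
      forall B, measurable B ->
        pi B = (\int[aug_ref muD pDa muTh]_(x in B) (piD x)%:E)%E,
      stationary K pi &
      forall (d0 : D) (disp' : measure_display) (W : measurableType disp')
        (P : probability W R)
        (X Y : nat -> W -> borel D * borel A * borel Th)
        (acc : nat -> W -> bool),
        daps_run muD pDa muTh uD pD gD d0 P X Y acc ->
        markov_chain P K X /\
        forall est : seq D -> D,
          consistent_mode_estimator P X (marginal_d pDa muTh piD) est ->
          {ae P, forall w, d_estimate est X w n @[n --> \oo] --> dARA}].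
Proof.
move=> pDa piD.
have [gD_meas gD_dens _] := gD_supp.
(* Compactness of the Defender's decision set enters as finiteness of its reference mass. *)
have muD_fin : (muD setT < +oo)%E by exact: muDK.
have [K KE] := daps_kernel scD scTh muD pDa muTh uD pD gD uD_pos uD_cont pD_meas
  pD_pos pD_dens gD_meas gD_dens.
have [pi [piE stat]] := aug_probability scD scTh muD pDa muTh uD pD gD uD_pos
  uD_cont pD_meas pD_pos pD_dens gD_meas gD_dens muD_fin psi_fin dARA dARA_opt.
exists K, pi; split=> //.
  by apply: stat => // B mB; exact: measurable_kernel.
move=> d0 disp' W P X Y acc run; split.
  exact: (daps_run_markov scD scTh muD pDa muTh uD pD gD uD_pos uD_cont pD_meas
    pD_pos gD_meas gD_dens P X Y acc d0 run).
(* Consistency is used at the candidate mode [dARA], which leaves its maximality for the marginal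
   density. *)
move=> est; apply.
exact: (argmax_marginal_d scD scTh muD pDa muTh uD pD gD uD_pos uD_cont pD_meas
  pD_pos pD_dens gD_meas gD_dens muD_fin psi_fin dARA dARA_opt).
Qed.
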